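(* Let $k\ge 1$, $m\ge 2$ and $d$ be integers with $$m<d\le \max\left(k+1,\; k^{m/(m-1)}/2\right).$$ Then there is an $m\times d$ integer matrix $A=(a_{ij})$ such that $|a_{ij}|\le k$ for all $i,j$ and all $m\times m$ submatrices of $A$ have full rank.
   Context: An $m\times m$ submatrix of an $m\times d$ matrix $A$ is the matrix formed by choosing $m$ distinct columns of $A$; full rank means that it is non-degenerate (nonzero determinant). *)

(* Defs.v *)
From mathcomp Require Import all_boot all_order all_algebra.
From mathcomp Require Import all_classical all_reals all_analysis.

Set Implicit Arguments.
Unset Strict Implicit.
Unset Printing Implicit Defensive.

Import Order.TTheory GRing.Theory Num.Theory.
Local Open Scope ring_scope.

(* The m x m submatrices of A are the [colsub f A] with f injective; the order
   in which f lists the chosen columns affects only the sign of the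
   determinant. *)
Definition all_maximal_submatrices_full_rank (m d : nat) (A : 'M[int]_(m, d)) :
    Prop :=
  forall f : 'I_m -> 'I_d, injective f -> \det (colsub f A) != 0.

(* Main.v *)
Require Import Defs.
From mathcomp Require Import all_boot all_order all_algebra.
From mathcomp Require Import all_classical all_reals all_analysis.
From mathcomp Require Import zify ring.

Set Implicit Arguments.
Unset Strict Implicit.
Unset Printing Implicit Defensive.

Import Order.TTheory GRing.Theory Num.Theory.

(** Let [p >= d] be a prime.  Over ['F_p] the points [(1, t, ..., t ^ (m - 1))]
    of the moment curve, for [d] distinct values of [t], form a Vandermonde
    matrix, so any [m] of them are linearly independent, and they remain so when
    each column is multiplied by a nonzero scalar of its own.  An integer matrix
    that reduces mod [p] to such a rescaled matrix has all its maximal minors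
    nonzero, because they are already nonzero mod [p] ([full_rank_of_lifts]).
    It remains to choose [p] and the scalars so that every column has a
    representative with entries in [[-k, k]].  There are two ways to do this,
    one for each term of the maximum.

    If [d <= k + 1], take [k < p <= 2 k].  Every residue mod [p] then has
    a representative of absolute value at most [k], and no rescaling is needed
    ([lift_balanced]).

    If [k + 1 < d] and [(2 d) ^ (m - 1) <= k ^ m], take [d < p <= 2 d], so that
    [p ^ (m - 1) < (k + 1) ^ m].  The integer vectors congruent mod [p] to
    a multiple of a given moment vector form a subgroup of index [p ^ (m - 1)]
    in [Z ^ m].  The box [[0, k] ^ m] has more points than that, so two of them
    differ by a nonzero element of the subgroup, and this element has entries in
    [[-k, k]] ([lift_pigeonhole]).

    Both choices of [p] come from Bertrand's postulate, proved here by Erdos's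
    argument.  If there were no prime in [(n, 2 n]], then the central binomial
    coefficient [C(2 n, n)], which is at least [4 ^ n / (2 n)], would have only
    prime factors up to [2 n / 3].  Those up to [sqrt (2 n)] contribute at most
    [2 n] each, the others occur to the first power and contribute together at
    most the primorial of [2 n / 3], which is at most [4 ^ (2 n / 3)]; this is
    too little once [n] is large ([bertrand_large]). *)

(** * Bertrand's postulate *)

(** Distinct primes are coprime, so their divisibilities multiply. *)
Lemma prod_primes_dvd a b N :
  (forall p, a <= p < b -> prime p -> p %| N) ->
  \prod_(a <= p < b | prime p) p %| N.
Proof.
elim: b => [|b IHb] dvdN; first by rewrite big_geq.
have [le_ab|lt_ba] := leqP a b; last by rewrite big_geq.
have IH : \prod_(a <= p < b | prime p) p %| N.
  by apply: IHb => p /andP[ap pb]; apply: dvdN; rewrite ap ltnW.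
rewrite big_mkcond big_nat_recr //= -big_mkcond /=.
case: ifP => [pr_b|_]; last by rewrite muln1.
rewrite Gauss_dvd ?IH ?dvdN ?le_ab ?ltnSn //=.
rewrite coprime_sym big_nat_cond.
elim/big_ind: _ => [|x y cx cy|p /andP[/andP[_ lt_pb] pr_p]].
- exact: coprimen1.
- by rewrite coprimeMr cx.
- by rewrite prime_coprime // gtnNdvd // prime_gt0.
Qed.

(** The two equal middle coefficients of [(1 + 1) ^ (2 m + 1)] together are at
    most the whole sum [2 * 4 ^ m]. *)
Lemma bin_odd_le m : 'C(m.*2.+1, m) <= 4 ^ m.
Proof.
rewrite -(leq_pmul2l (isT : 0 < 2)).
have -> : 2 * 4 ^ m = 2 ^ m.*2.+1 by rewrite expnS -mul2n expnM.
have -> : 2 ^ m.*2.+1 = \sum_(0 <= i < m.*2.+2) 'C(m.*2.+1, i).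
  rewrite (_ : 2 = 1 + 1) // expnDn big_mkord; apply: eq_bigr => i _.
  by rewrite !exp1n !muln1.
rewrite (big_cat_nat (n := m)) //=; last by lia.
rewrite [X in _ + X]big_ltn; last by lia.
rewrite [X in _ + (_ + X)]big_ltn; last by lia.
have -> : 'C(m.*2.+1, m.+1) = 'C(m.*2.+1, m).
  rewrite -bin_sub; last by lia.
  by congr 'C(_, _); lia.
lia.
Qed.

(** Strong induction.  An even [n > 2] is not prime and adds nothing; for
    [n = 2 m + 1] the primes above [m + 1] divide [(2 m + 1)!] but neither [m!]
    nor [(m + 1)!], so their product divides [C(2 m + 1, m) <= 4 ^ m]. *)
Lemma primorial_le n : \prod_(0 <= p < n.+1 | prime p) p <= 4 ^ n.
Proof.
have [N] := ubnP n; elim: N n => // N IH n lt_nN.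
have [n_le2|n_gt2] := leqP n 2.
  by case: n n_le2 {lt_nN} => [|[|[|]]] //; rewrite unlock.
have [n_odd|n_even] := boolP (odd n); last first.
  rewrite big_mkcond big_nat_recr //= -big_mkcond /=.
  have /negPf -> : ~~ prime n by apply/negP => /even_prime []; lia.
  rewrite muln1; apply: leq_trans (leq_pexp2l _ (leq_pred n)) => //.
  by have := IH n.-1; rewrite prednK; last lia; apply; lia.
have [m def_n] : exists m, n = m.*2.+1 by exists n./2; lia.
rewrite {}def_n in lt_nN n_gt2 *.
rewrite (big_cat_nat (n := m.+2)) //=; last by lia.
rewrite (_ : m.*2.+1 = m.+1 + m) ?expnD; last by lia.
apply: leq_mul; first by apply: IH; lia.
apply: leq_trans (bin_odd_le m); apply: dvdn_leq; first by rewrite bin_gt0; lia.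
apply: prod_primes_dvd => p /andP[lt_mp le_p] pr_p.
have le_m : m <= m.*2.+1 by lia.
have def_fact := bin_fact le_m.
have : p %| (m.*2.+1)`! by apply: dvdn_fact; rewrite prime_gt0 //=; lia.
have p_ndvd j : j < p -> ~~ (p %| j`!).
  move=> lt_jp; elim: j lt_jp => [|j IHj] lt_jp.
    by rewrite fact0 dvdn1; have := prime_gt1 pr_p; lia.
  by rewrite factS Euclid_dvdM // negb_or gtnNdvd //= IHj // ltnW.
by rewrite -def_fact !Euclid_dvdM // => /or3P[//||]; apply: contraTT => _;
  apply: p_ndvd; lia.
Qed.

(** Induction on [n]: [C(2 n + 2, n + 1) / C(2 n, n) = 2 (2 n + 1) / (n + 1)],
    which is at least [4 n / (n + 1)]. *)
Lemma central_bin_ge n : 0 < n -> 4 ^ n <= n.*2 * 'C(n.*2, n).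
Proof.
case: n => // n _; elim: n => [|n IHn]; first by [].
suff rec j : j.+1 * 'C(j.+1.*2, j.+1) = 2 * (j.*2.+1 * 'C(j.*2, j)).
  have := rec n.+1; move: IHn; rewrite [4 ^ n.+2]expnS; nia.
have down := mul_bin_down j.*2.+1 j.
have sym : 'C(j.*2.+1, j.+1) = 'C(j.*2.+1, j).
  rewrite -bin_sub; last by lia.
  by congr 'C(_, _); lia.
rewrite doubleS.
have pascal : 'C(j.*2.+2, j.+1) = 2 * 'C(j.*2.+1, j) by rewrite binS sym; lia.
rewrite pascal; move: down; rewrite (_ : j.*2.+1 - j = j.+1) /=; last by lia.
nia.
Qed.

(** Legendre's formula for [(2 n)! = C(2 n, n) * n! * n!].  Both sums run up to
    [2 n], so that they can be compared term by term; the extra terms for [n!]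
    vanish. *)
Lemma logn_central_bin p n : prime p ->
  logn p 'C(n.*2, n) + 2 * (\sum_(1 <= k < n.*2.+1) n %/ p ^ k)
    = \sum_(1 <= k < n.*2.+1) n.*2 %/ p ^ k.
Proof.
move=> pr_p; rewrite -logn_fact //.
have -> : \sum_(1 <= k < n.*2.+1) n %/ p ^ k = logn p n`!.
  rewrite logn_fact // (big_cat_nat (n := n.+1)) //=; last by lia.
  rewrite [X in _ + X]big_nat [X in _ + X]big1 ?addn0 // => k /andP[lt_nk _].
  by rewrite divn_small //; apply: ltn_trans (ltn_expl _ (prime_gt1 pr_p)).
have le_n : n <= n.*2 by lia.
have /(congr1 (logn p)) := bin_fact le_n.
rewrite (_ : n.*2 - n = n); last by lia.
have C_gt0: 0 < 'C(n.*2, n) by rewrite bin_gt0; lia.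
by rewrite !lognM ?muln_gt0 ?fact_gt0 // => <-; lia.
Qed.

Lemma divn_double_le n q : n.*2 %/ q <= 2 * (n %/ q) + 1.
Proof.
have [->|q_gt0] := posnP q; first by rewrite !divn0.
rewrite -ltnS ltn_divLR //.
have := divn_eq n q; have := ltn_pmod n q_gt0; nia.
Qed.

(** In the difference of the two sums of Legendre's formula, each power [p ^ k]
    contributes at most 1, and nothing once it exceeds [2 n]. *)
Lemma logn_central_bin_le p n : prime p ->
  logn p 'C(n.*2, n) <= trunc_log p n.*2.
Proof.
move=> pr_p; have p_gt1 := prime_gt1 pr_p.
rewrite -(leq_add2r (2 * \sum_(1 <= k < n.*2.+1) n %/ p ^ k)).
rewrite logn_central_bin // big_distrr /=.
set t := trunc_log p n.*2.
have [->|n_gt0] := posnP n; first by rewrite big_geq.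
have t_le : t <= n.*2.
  by apply: ltnW; apply: leq_trans (ltn_expl _ p_gt1) (trunc_logP _ _); lia.
rewrite !(big_cat_nat (n := t.+1) (m := 1) (p := n.*2.+1)) //=.
rewrite [X in _ + X <= _]big_nat [X in _ + X <= _]big1 => [|k /andP[lt_tk _]].
  rewrite addn0 addnA; apply: leq_trans (leq_addr _ _).
  have sum_t : \sum_(1 <= k < t.+1) 1 = t by rewrite sum_nat_const_nat; lia.
  rewrite -[X in _ <= X + _]sum_t -big_split; apply: leq_sum => k _ /=.
  by rewrite addnC; apply: divn_double_le.
have : n.*2 < p ^ k.
  by apply: leq_trans (trunc_log_ltn _ p_gt1) _; rewrite leq_exp2l.
by move=> /divn_small ->.
Qed.

Lemma pfactor_central_bin_le p n : 0 < n -> prime p ->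
  p ^ logn p 'C(n.*2, n) <= n.*2.
Proof.
move=> n_gt0 pr_p; have p_gt1 := prime_gt1 pr_p.
apply: leq_trans (trunc_logP p_gt1 _); last by lia.
by rewrite leq_pexp2l ?logn_central_bin_le // prime_gt0.
Qed.

(** Here [p] occurs exactly twice in [(2 n)!] and once in [n!], as its only
    multiples up to [2 n] are [p] and [2 p], and [p ^ 2] exceeds [2 n]. *)
Lemma logn_central_bin_eq0 p n : prime p -> 2 < p ->
  n.*2 < 3 * p -> n.*2 < p ^ 2 -> p <= n -> logn p 'C(n.*2, n) = 0.
Proof.
move=> pr_p p_gt2 lt_3p lt_p2 le_pn.
apply/eqP; rewrite -(eqn_add2r (2 * \sum_(1 <= k < n.*2.+1) n %/ p ^ k)).
rewrite logn_central_bin // add0n big_distrr /=; apply/eqP.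
apply: eq_big_nat => k /andP[k_gt0 _].
have [k_gt1|k_le1] := ltnP 1 k.
  have lt_pk : n.*2 < p ^ k.
    by apply: leq_trans lt_p2 _; rewrite leq_pexp2l //; lia.
  by rewrite !divn_small //; lia.
have -> : k = 1 by lia.
have p_gt0 := prime_gt0 pr_p; rewrite expn1.
have q1 : n %/ p = 1 by apply/anti_leq; rewrite leq_divRL // -ltnS ltn_divLR //; lia.
have q2 : n.*2 %/ p = 2.
  by apply/anti_leq; rewrite leq_divRL // -ltnS ltn_divLR //; lia.
by rewrite q1 q2.
Qed.

Lemma prod_nat_le a b (P : pred nat) (F : nat -> nat) c : 0 < c ->
  (forall i, a <= i < b -> P i -> F i <= c) ->
  \prod_(a <= i < b | P i) F i <= c ^ (b - a).
Proof.
move=> c_gt0 le_Fc; rewrite -prod_nat_const_nat big_mkcond /=.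
rewrite !big_nat; apply: leq_prod => i ab_i.
by case: ifP => // /(le_Fc i ab_i).
Qed.

(** Erdos's upper bound on [C(2 n, n)] when there is no prime in [(n, 2 n]].
    The parameter [s] stands for the integer square root of [2 n]: there are at
    most [s - 1] primes up to [s], each contributing at most [2 n], and a prime
    above [s] divides [C(2 n, n)] at most once, as its square exceeds [2 n]. *)
Lemma central_bin_no_prime n s :
  1 < s -> n.*2 < s.+1 ^ 2 -> s <= n.*2 %/ 3 ->
  (forall p, n < p <= n.*2 -> ~~ prime p) ->
  'C(n.*2, n) <= n.*2 ^ s.-1 * 4 ^ (n.*2 %/ 3).
Proof.
move=> s_gt1 lt_ns le_s noprime.
set u := n.*2 %/ 3 in le_s *; set C := 'C(n.*2, n).
have n_gt0 : 0 < n by rewrite /u in le_s; case: (n) le_s s_gt1 => //=; lia.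
have C_gt0 : 0 < C by rewrite bin_gt0; lia.
(* The factorization is written over a range long enough to be cut at [s] and
   at [u], whether or not [C] exceeds [2 n]. *)
pose M := maxn C n.*2.
have lt_uM : u < M by rewrite leq_max orbC /u; apply/orP; left; lia.
have {1}-> : C = \prod_(0 <= p < M.+1 | prime p) p ^ logn p C.
  rewrite -[LHS]partnT // (@widen_partn M) ?leq_maxl //.
  rewrite big_mkcond [RHS]big_mkcond; apply: eq_bigr => p _ /=.
  by case: ifP => // npr_p; rewrite lognE npr_p.
rewrite (big_cat_nat (n := s.+1)) //=; last by lia.
apply: leq_mul.
  rewrite (big_cat_nat (n := 2)) //=; last by lia.
  rewrite [X in X * _](_ : _ = 1) ?mul1n; last by rewrite unlock.
  rewrite (_ : s.-1 = s.+1 - 2); last by lia.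
  by apply: prod_nat_le => [|p _ pr_p]; [lia | apply: pfactor_central_bin_le].
rewrite (big_cat_nat (n := u.+1)) //=; last by lia.
rewrite [X in _ * X]big_nat_cond [X in _ * X]big1 ?muln1.
  apply: leq_trans (primorial_le u).
  rewrite [X in _ <= X](big_cat_nat (n := s.+1)) //=.
  apply: leq_trans (leq_pmull _ _); last first.
    by apply: prodn_cond_gt0 => p /prime_gt0.
  rewrite big_nat_cond [X in _ <= X]big_nat_cond.
  apply: leq_prod => p /andP[/andP[lt_sp _] pr_p].
  rewrite -[X in _ <= X]expn1 leq_pexp2l ?prime_gt0 //.
  apply: leq_trans (logn_central_bin_le _ pr_p) _.
  rewrite -ltnS -(ltn_exp2l _ _ (prime_gt1 pr_p)).
  apply: leq_ltn_trans (trunc_logP (prime_gt1 pr_p) _) _; first by lia.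
  by apply: leq_trans lt_ns _; rewrite leq_exp2r.
move=> p /andP[/andP[lt_up _] pr_p].
have [le_pn|lt_np] := leqP p n.
  rewrite logn_central_bin_eq0 //; first by lia.
    by rewrite /u in lt_up; lia.
  by apply: leq_trans lt_ns _; rewrite leq_exp2r //; lia.
have [le_p2n|lt_2np] := leqP p n.*2.
  by have := noprime p; rewrite lt_np le_p2n pr_p => /(_ isT).
rewrite (_ : logn p C = 0) //; apply/eqP; rewrite -leqn0.
apply: leq_trans (logn_central_bin_le _ pr_p) _.
by rewrite -ltnS -(ltn_exp2l _ _ (prime_gt1 pr_p));
  apply: leq_ltn_trans (trunc_logP (prime_gt1 pr_p) _) _; lia.
Qed.

Lemma sqr_le_exp2 t : 11 <= t -> (3 * t.+1) ^ 2 <= 2 ^ t.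
Proof.
move=> /subnKC <-; elim: (t - 11) => [|j IHj]; first by [].
by rewrite addnS [2 ^ _]expnS; move: IHj; rewrite -!mulnn; nia.
Qed.

(** The two bounds on [C(2 n, n)] give [4 ^ (n - 2 n / 3) <= (2 n) ^ s], with
    [s] the integer square root of [2 n].  If [2 ^ t <= 2 n < 2 ^ (t + 1)], the
    right-hand side is below [2 ^ ((t + 1) s)], and [3 (t + 1) <= s] makes this
    at most [2 ^ (2 n / 3)], hence at most the left-hand side.  The bound [n >= 1024] ensures
    [t >= 11], hence [(3 (t + 1)) ^ 2 <= 2 ^ t]. *)
Lemma bertrand_large n : 1024 <= n -> exists p, [/\ prime p, n < p & p <= n.*2].
Proof.
move=> n_ge.
have [/hasP[p]|/hasPn noprime] := boolP (has prime (index_iota n.+1 n.*2.+1)).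
  by rewrite mem_index_iota => /andP[lt_np le_p] pr_p; exists p.
have exs : exists s, s ^ 2 <= n.*2 by exists 0.
have bs s : s ^ 2 <= n.*2 -> s <= n.*2 by rewrite -mulnn; nia.
case: (ex_maxnP exs bs) => s le_s2 max_s.
have lt_s : n.*2 < s.+1 ^ 2.
  by rewrite ltnNge; apply/negP => /max_s; rewrite ltnn.
have [t_le t_gt] : 2 ^ trunc_log 2 n.*2 <= n.*2 /\ n.*2 < 2 ^ (trunc_log 2 n.*2).+1.
  by split; [apply: trunc_logP; lia | apply: trunc_log_ltn].
have t_ge : 11 <= trunc_log 2 n.*2.
  apply: trunc_log_max => //; apply: (@leq_trans (1024.*2)); last by lia.
  by [].
move: (trunc_log _ _) t_le t_gt t_ge => t t_le t_gt t_ge.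
have le_ts : 3 * t.+1 <= s.
  by apply: max_s; apply: leq_trans t_le; apply: sqr_le_exp2.
have le_su : s <= n.*2 %/ 3 by rewrite leq_divRL //; move: le_s2; rewrite -mulnn; nia.
have le_C : 'C(n.*2, n) <= n.*2 ^ s.-1 * 4 ^ (n.*2 %/ 3).
  apply: central_bin_no_prime => // [|p lt_np]; first by lia.
  by apply: noprime; rewrite mem_index_iota.
have n_gt0 : 0 < n by lia.
have := central_bin_ge n_gt0.
rewrite leqNgt => /negP[].
apply: (@leq_ltn_trans (n.*2 ^ s * 4 ^ (n.*2 %/ 3))).
  have -> : n.*2 ^ s = n.*2 * n.*2 ^ s.-1 by rewrite -expnS prednK //; lia.
  by rewrite -mulnA leq_mul2l le_C orbT.
have def_n : n = n - n.*2 %/ 3 + n.*2 %/ 3 by lia.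
rewrite [X in _ < 4 ^ X]def_n expnD ltn_pmul2r ?expn_gt0 //.
apply: (@leq_trans (2 ^ (t.+1 * s))).
  by rewrite expnM ltn_exp2r //; lia.
rewrite (_ : 4 = 2 ^ 2) // -expnM leq_exp2l //.
by move: le_s2; rewrite -mulnn; nia.
Qed.

Lemma bertrand n : 0 < n -> exists p, [/\ prime p, n < p & p <= n.*2].
Proof.
move=> n_gt0; have [/bertrand_large//|n_lt] := leqP 1024 n.
pose has_prime := exists p, [/\ prime p, n < p & p <= n.*2].
have step q r : prime r -> r <= q.*2 -> (n < q -> has_prime) -> n < r -> has_prime.
  move=> pr_r le_r below lt_nr; have [/below//|le_qn] := ltnP n q.
  by exists r; split=> //; lia.
(* Each prime of this chain is at most twice the next smaller one, so the least
   of them above [n] is at most [2 n]. *)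
have : n < 1259 by lia.
apply: (step 631) => //; apply: (step 317) => //; apply: (step 163) => //.
apply: (step 83) => //; apply: (step 43) => //; apply: (step 23) => //.
apply: (step 13) => //; apply: (step 7) => //; apply: (step 5) => //.
apply: (step 3) => //; apply: (step 2) => //; apply: (step 1) => //.
by lia.
Qed.

(** * Short integer representatives of moment vectors *)

Local Open Scope ring_scope.

(** The column indexed by [t] is only determined up to a nonzero factor [c],
    which is what leaves room to make [x] short. *)
Definition lifts_moment_ray (p m k : nat) (t : 'F_p) (x : 'I_m -> int) : Prop :=
  (forall i, `|x i| <= k%:Z) /\
  exists2 c : 'F_p, c != 0 & forall i, (x i)%:~R = c * t ^+ i.

Lemma Fp_natr_inj p (a b : nat) : prime p -> (a < p)%N -> (b < p)%N ->
  a%:R = b%:R :> 'F_p -> a = b.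
Proof.
move=> pr_p lt_a lt_b /(congr1 (@nat_of_ord _)).
by rewrite !val_Fp_nat // !modn_small.
Qed.

(** A maximal minor reduces mod [p] to a Vandermonde determinant times the
    product of the factors of the chosen columns. *)
Lemma full_rank_of_lifts p m d k : prime p -> (d <= p)%N ->
  (forall t : 'F_p, exists x : 'I_m -> int, lifts_moment_ray k t x) ->
  exists A : 'M[int]_(m, d),
    (forall i j, `|A i j| <= k%:Z) /\ all_maximal_submatrices_full_rank A.
Proof.
move=> pr_p le_dp lift_ex; pose t (j : 'I_d) : 'F_p := (j : nat)%:R.
have /choice [X XP] := fun j => lift_ex (t j).
have /choice [c cP] : forall j, exists c : 'F_p,
    c != 0 /\ forall i, (X j i)%:~R = c * t j ^+ i.
  by move=> j; have [_ [c c0 cE]] := XP j; exists c.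
exists (\matrix_(i, j) X j i); split=> [i j|f f_inj].
  by rewrite mxE; have [] := XP j.
suff : (\det (colsub f (\matrix_(i, j) X j i)))%:~R != 0 :> 'F_p.
  by apply: contraNneq => ->.
rewrite -(det_map_mx (intmul 1)).
have -> : map_mx (intmul 1) (colsub f (\matrix_(i, j) X j i))
    = Vandermonde m (\row_j t (f j)) *m diag_mx (\row_j c (f j)) :> 'M['F_p]_m.
  apply/matrixP => i j; rewrite mul_mx_diag !mxE mulrC.
  by have [_ ->] := cP (f j).
rewrite det_mulmx det_Vandermonde det_diag mulf_neq0 //.
  apply/prodf_neq0 => i _; apply/prodf_neq0 => j lt_ij.
  rewrite !mxE subr_eq0; apply: contraTneq lt_ij => /Fp_natr_inj E.
  have /f_inj -> : f j = f i by apply/val_inj/E => //; apply: leq_trans le_dp.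
  by rewrite ltnn.
by apply/prodf_neq0 => i _; rewrite mxE; have [] := cP (f i).
Qed.

Lemma balanced_residue p k (a : 'F_p) : prime p -> (p <= k.*2.+1)%N ->
  exists2 z : int, `|z| <= k%:Z & z%:~R = a.
Proof.
move=> pr_p le_pk; have lt_ap : (a < p)%N by rewrite -[X in (_ < X)%N](Fp_cast pr_p).
have [le_ak|lt_ka] := leqP a k.
  by exists (a : nat)%:Z; [lia | apply: natr_Zp].
exists ((a : nat)%:Z - p%:Z); first by lia.
by rewrite rmorphB /= -!pmulrn pchar_Fp_0 // subr0 natr_Zp.
Qed.

Lemma lift_balanced p m k (t : 'F_p) : prime p -> (p <= k.*2.+1)%N ->
  exists x : 'I_m -> int, lifts_moment_ray k t x.
Proof.
move=> pr_p le_pk.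
have /choice [x xP] : forall i : 'I_m, exists z : int,
    `|z| <= k%:Z /\ z%:~R = t ^+ i.
  by move=> i; have [z] := balanced_residue (t ^+ i) pr_p le_pk; exists z.
exists x; split=> [i|]; first by have [] := xP i.
by exists 1 => [|i]; [apply: oner_neq0 | rewrite mul1r; have [] := xP i].
Qed.

Lemma Fp_int_eq0 p (z : int) : prime p -> `|z| < p%:Z ->
  z%:~R = 0 :> 'F_p -> z = 0.
Proof.
move=> pr_p lt_z z0; suff : `|z|%N = 0%N by lia.
have lt_abs : (`|z| < p)%N by lia.
apply: (Fp_natr_inj pr_p lt_abs (prime_gt0 pr_p)).
have [E|E] : z = `|z|%N \/ z = - `|z|%N%:Z by lia.
  by rewrite pmulrn -E.
by apply: oppr_inj; rewrite oppr0 pmulrn -rmorphN /= -E.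
Qed.

(** The map [g] below records the class of a point of the box [[0, k] ^ m]
    modulo the vectors that are proportional to [(t ^ i)_i] mod [p], and [count]
    says that it has fewer values than arguments.  The difference [x] of two
    points with the same value is [x_0] times the moment vector mod [p]; the
    factor [x_0] is nonzero, as otherwise [x], with entries below [p] in absolute
    value, would vanish. *)
Lemma lift_pigeonhole p m k (t : 'F_p) : prime p -> (0 < m)%N ->
  (k < p)%N -> (p ^ m.-1 < k.+1 ^ m)%N ->
  exists x : 'I_m -> int, lifts_moment_ray k t x.
Proof.
case: m => // m pr_p _ lt_kp /= count.
pose g (u : {ffun 'I_m.+1 -> 'I_k.+1}) : {ffun 'I_m -> 'F_p} :=
  [ffun i => (u (lift ord0 i) : nat)%:R - (u ord0 : nat)%:R * t ^+ i.+1].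
have /injectivePn [u [v neq_uv eq_g]] : ~~ injectiveb g.
  apply: contraL count => /injectiveP /leq_card.
  by rewrite !card_ffun !card_ord Fp_cast // -leqNgt.
pose x i : int := (u i : nat)%:Z - (v i : nat)%:Z.
have x_le i : `|x i| <= k%:Z by rewrite /x; have := ltn_ord (u i); have := ltn_ord (v i); lia.
have xE i : (x i)%:~R = (x ord0)%:~R * t ^+ i.
  case: (unliftP ord0 i) => [j|] ->; last by rewrite expr0 mulr1.
  have /ffunP/(_ j) := eq_g; rewrite !ffunE => /(canRL (subrK _)) u_j.
  by rewrite /x !rmorphB /= -!pmulrn u_j; ring.
exists x; split=> //; exists (x ord0)%:~R => //.
apply: contraNneq neq_uv => x0; apply/eqP/ffunP => i; apply/val_inj => /=.
suff /eqP : x i = 0 by rewrite subr_eq0 => /eqP [].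
apply: (@Fp_int_eq0 p) => //; first by have := x_le i; lia.
by rewrite xE x0 mul0r.
Qed.

(** * Matrices with bounded entries *)

Theorem theorem1p3 (R : realType) (k m d : nat)
  (hk : (1 <= k)%N) (hm : (2 <= m)%N) (hmd : (m < d)%N)
  (hd : (d%:R : R) <=
        Num.max (k%:R + 1) ((k%:R `^ (m%:R / (m%:R - 1))) / 2%:R)) :
  exists A : 'M[int]_(m, d),
    (forall (i : 'I_m) (j : 'I_d), `|A i j| <= k%:Z) /\
    all_maximal_submatrices_full_rank A.
Proof.
have [le_dk|lt_kd] := leqP d k.+1.
  have [p [pr_p lt_kp le_p]] := bertrand hk.
  apply: (full_rank_of_lifts pr_p) => [|t]; first by lia.
  by apply: lift_balanced; lia.
have [p [pr_p lt_dp le_p]] := @bertrand d ltac:(lia).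
apply: (full_rank_of_lifts pr_p) => [|t]; first by lia.
apply: lift_pigeonhole => //; [by lia | by lia |].
have le_2d : (d.*2)%:R <= k%:R `^ (m%:R / (m%:R - 1)) :> R.
  move: hd; rewrite le_max natr1 ler_nat leqNgt lt_kd /=.
  by rewrite ler_pdivlMr ?ltr0n // -natrM muln2.
(* Raising [2 d <= k ^ (m / (m - 1))] to the power [m - 1] clears the
   fractional exponent. *)
have le_pow : (p ^ m.-1 <= k ^ m)%N.
  rewrite -(ler_nat R) !natrX -[X in _ <= X]powR_mulrn ?ler0n //.
  have -> : m%:R = m%:R / (m%:R - 1) * m.-1%:R :> R.
    have -> : m%:R - 1 = m.-1%:R :> R by rewrite -subn1 natrB //; lia.
    by rewrite divfK // pnatr_eq0; lia.
  rewrite powRrM powR_mulrn ?powR_ge0 // lerXn2r ?nnegrE ?powR_ge0 ?ler0n //.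
  by apply: le_trans le_2d; rewrite ler_nat.
by apply: leq_ltn_trans le_pow _; rewrite ltn_exp2r //; lia.
Qed.
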